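(* There is an absolute constant $K>0$ such that the following holds. Let $\mathcal{G}=\{G^{(t)}\}_{t=1}^{\infty}$ be a sequence of connected undirected graphs on the same set $V$ of $n\ge 2$ vertices, such that the lazy random walks on all $G^{(t)}$ have the same stationary distribution $\pi$, and each $G^{(t)}$ has at most $m^*$ edges. Let $\pi_*=\min_{x\in V}\pi(x)$. Then, for the lazy random walk on $\mathcal{G}$: 1. $t_{\mathrm{mix}}(\mathcal{G})\le K\, n/\pi_*$. 2. For all $u,v\in V$ and all $t\ge 1$, $\left|\frac{p^{[0,t]}_{u,v}}{\pi(v)}-1\right|\le K\left(\frac{m^*}{t}+\frac{1}{\pi_*\sqrt{t}}\right)$; moreover, if all graphs in $\mathcal{G}$ are $d$-regular, then $\left|\frac{p^{[0,t]}_{u,v}}{\pi(v)}-1\right|\le K\frac{n}{\sqrt{t}}$. 3. $t_{\mathrm{hit}}(\mathcal{G})\le K\, \frac{n\log n}{\pi_*}$; furthermore, if all graphs in $\mathcal{G}$ are $d$-regular, then $t_{\mathrm{hit}}(\mathcal{G})\le K n^2$.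
   Context: All graphs are simple, undirected, unweighted. The lazy random walk on $\mathcal{G}=\{G^{(t)}\}_{t\ge1}$ is the time-inhomogeneous Markov chain whose $t$-th step uses the transition matrix $P^{(t)}$ of the lazy walk on $G^{(t)}$: $P^{(t)}(u,u)=1/2$, $P^{(t)}(u,v)=1/(2d_u)$ if $u,v$ are adjacent in $G^{(t)}$ (with $d_u$ the degree of $u$ in $G^{(t)}$), and $0$ otherwise. For $t_1\le t_2$, $p^{[t_1,t_2]}_{u,v}=(P^{(t_1+1)}P^{(t_1+2)}\cdots P^{(t_2)})(u,v)$ is the probability that the walk at $u$ at time $t_1$ is at $v$ at time $t_2$. Put $\rho^{[0,t]}_{u,\cdot}=p^{[0,t]}_{u,\cdot}/\pi(\cdot)$ and $\|f\|_{2,\pi}=\left(\sum_{x\in V} f(x)^2\pi(x)\right)^{1/2}$. The ($\ell_2$) mixing time is $t_{\mathrm{mix}}(\mathcal{G})=\min\{t:\ \|\rho^{[0,t]}_{u,\cdot}-1\|_{2,\pi}\le 1/3 \text{ for all } u\in V\}$. The maximum hitting time is $t_{\mathrm{hit}}(\mathcal{G})=\max_{u,v}\tau_{u,v}$, where $\tau_{u,v}$ is the expected time for the walk started at $u$ at time $0$ to first reach $v$. *)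

(* Defs.v *)
From HB Require Import structures.
From mathcomp Require Import all_boot all_order all_algebra.
From mathcomp Require Import all_classical all_reals all_analysis.

Set Implicit Arguments.
Unset Strict Implicit.
Unset Printing Implicit Defensive.

Import Order.TTheory GRing.Theory Num.Theory.

Local Open Scope ring_scope.

Record sgraph (V : finType) := SGraph {
  adj :> rel V;
  adj_sym : symmetric adj;
  adj_irr : irreflexive adj }.

Section Graphs.
Context {V : finType}.
Implicit Type G : sgraph V.

Definition edges G : {set {set V}} :=
  [set [set e.1; e.2] | e in [set e : V * V | adj G e.1 e.2]].

Definition degree G (u : V) : nat := #|[set v | adj G u v]|.

Definition connected_graph G : Prop := forall u v, connect (adj G) u v.

Definition regular_graph (d : nat) G : Prop := forall u, degree G u = d.

End Graphs.

Section LazyWalk.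
Context {R : realType} {V : finType}.

Definition lazy (G : sgraph V) (u v : V) : R :=
  if u == v then 1 / 2
  else if adj G u v then 1 / (2 * (degree G u)%:R)
  else 0.

Definition lazy_mx (G : sgraph V) : 'M[R]_#|V| :=
  \matrix_(i, j) lazy G (enum_val i) (enum_val j).

(* A graph sequence is indexed by t >= 1; the value [G 0] is never used:
   the step from time s to time s.+1 is made on [G s.+1]. *)
Variable G : nat -> sgraph V.

(* P^(t1+1) P^(t1+2) ... P^(t2) *)
Definition walk_mx (t1 t2 : nat) : 'M[R]_#|V| :=
  \prod_(t1 <= s < t2) lazy_mx (G s.+1).

Definition walk_prob (t1 t2 : nat) (u v : V) : R :=
  walk_mx t1 t2 (enum_rank u) (enum_rank v).

(* Probability of following the trajectory x_0, ..., x_t, given X_0 = x_0. *)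
Definition traj_prob (t : nat) (x : {ffun 'I_t.+1 -> V}) : R :=
  \prod_(s < t) lazy (G s.+1) (x (inord s)) (x (inord s.+1)).

(* Probability that the walk started at u at time 0 first reaches v at time t
   (time 0 counts, so the hitting time of u from u is 0). *)
Definition first_hit_prob (u v : V) (t : nat) : R :=
  \sum_(x : {ffun 'I_t.+1 -> V} |
      [&& x ord0 == u, x ord_max == v
        & [forall s : 'I_t.+1, (s < t)%N ==> (x s != v)]]) traj_prob x.

(* Expectation of the hitting time T, a random variable with values in
   {0, 1, ...} U {+oo}: the last summand is +oo * Pr(T = +oo), which is 0 when
   v is reached almost surely since +oo * 0 = 0. *)
Definition expected_hitting_time (u v : V) : \bar R :=
  (\sum_(0 <= t <oo) (t%:R * first_hit_prob u v t)%:E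
   + +oo * (1 - \sum_(0 <= t <oo) (first_hit_prob u v t)%:E))%E.

Definition t_hit : \bar R :=
  \big[Order.max/-oo%E]_(e : V * V) expected_hitting_time e.1 e.2.

Variable pi : V -> R.

Definition norm2 (f : V -> R) : R := Num.sqrt (\sum_x f x ^+ 2 * pi x).

Definition rho (t : nat) (u x : V) : R := walk_prob 0 t u x / pi x.

(* The minimum of the set of mixed times, +oo if there is none. *)
Definition t_mix : \bar R :=
  ereal_inf [set t%:R%:E | t in
    [set t : nat | forall u, norm2 (fun x => rho t u x - 1) <= 1 / 3]]%classic.

End LazyWalk.

Section Stationary.
Context {R : realType} {V : finType}.
Variable pi : V -> R.

Definition is_distribution : Prop :=
  (forall x, 0 <= pi x) /\ \sum_x pi x = 1.

Definition stationary (G : sgraph V) : Prop :=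
  is_distribution /\ forall v, \sum_u pi u * lazy G u v = pi v.

(* The default value 1 does not affect the minimum: a distribution is <= 1. *)
Definition pi_min : R := \big[Order.min/1]_x pi x.

End Stationary.

Arguments t_hit R {V} G.

(* Main.v *)
Require Import Defs.
From mathcomp Require Import all_boot all_order all_algebra.
From mathcomp Require Import all_classical all_reals all_analysis.
From mathcomp Require Import ring lra zify.

(** Write $p$ for a lower bound of $\pi$, $n$ for the number of vertices and
$\varphi = \|f - 1\|_{2,\pi}^2$ for the variance of a density $f$ with respect to
$\pi$.

One step. A stationary distribution of a connected graph is proportional to the
degree, $\pi(x) = c\, d_x$ [stationary_degree], so every step is reversible and
sends the density $f$ of the walk to $P f$ [forward_densityS]. Laziness gives
$\varphi(Pf) \le \varphi(f) - (c/4) D(f)$, with $D(f)$ the sum of $(f(x)-f(y))^2$ over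
ordered adjacent pairs [variance_lazy_op]. The step therefore needs only a lower
bound on $D$, uniform over all graphs, and the time-dependence of the graph
disappears.

Lower bound on the energy. Let $f(x_0) > a$, $S = \{f > a\}$, and let $\delta$ be a
lower bound of the degrees. Then $\delta (f(x_0) - a)^2 \le 5 |S| D(f)$
[edge_energy_cut]: either half of the edges at $x_0$ leave $S$, or a shortest
path from $x_0$ out of $S$ has length at most $5|S|/\delta$, since each vertex of
$S$ has at most three neighbours on it. As $\max f \ge 1 + \varphi$, cutting at
$a = \min f$ gives a quadratic decay $\varphi \mapsto \varphi - p \varphi^2/(20n)$, and cutting at
$a = \max f/2$, where Markov's inequality bounds $|S|$, gives a cubic one,
$\varphi \mapsto \varphi - p^2 \varphi^3/160$. Iterating [variance_evolution_mixing] and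
[variance_evolution_nash], $\varphi_i \le 20n/(p(i+1))$ and
$\varphi_i^2 \le 160/(p^2(i+1))$. The first bound is the mixing time.

Pointwise bounds. Split the time interval in the middle and apply
Cauchy-Schwarz to the density of the walk from $u$ on the first half and the
density of the time-reversed walk from $v$ on the second half
[walk_prob_half]. This yields $O(n/(pt))$ and $O(1/(p\sqrt t))$ for
$|p^{[0,t]}_{u,v}/\pi(v) - 1|$; a regular graph has $p = 1/n$.

Hitting times. During $[s+T, s+2T)$, with $T$ of order $n/p$, the walk makes at
least $T\pi(v)/2$ expected visits to $v$, while after a visit to $v$ the expected
number of visits in the remaining window is at most $B$, which the pointwise
bounds control. Hence $v$ is hit in the window with probability at least
$T\pi(v)/(2B)$ [survival_contraction], whatever the past. The harmonic sum of the
bounds $n/(p\,i)$ costs a logarithm; in the regular case the bounds $n/\sqrt i$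
have a sum of order $T$, and no logarithm appears. *)

Set Implicit Arguments.
Unset Strict Implicit.
Unset Printing Implicit Defensive.

Import Order.TTheory GRing.Theory Num.Theory.

Local Open Scope ring_scope.

(** * Finite Cauchy-Schwarz inequalities *)

Lemma cauchy_schwarz_sum (R : realFieldType) (I : finType) (w a b : I -> R) :
    (forall i, 0 <= w i) ->
  (\sum_i w i * (a i * b i)) ^+ 2
    <= (\sum_i w i * a i ^+ 2) * (\sum_i w i * b i ^+ 2).
Proof.
move=> w0.
have h : 0 <= \sum_i \sum_j w i * w j * (a i * b j - a j * b i) ^+ 2.
  by apply: sumr_ge0 => i _; apply: sumr_ge0 => j _; rewrite mulr_ge0 ?sqr_ge0 ?mulr_ge0.
set A := \sum_i w i * a i ^+ 2; set B := \sum_i w i * b i ^+ 2.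
set C := \sum_i _.
(* Lagrange's identity *)
suff e : \sum_i \sum_j w i * w j * (a i * b j - a j * b i) ^+ 2
         = A * B + B * A - 2 * (C * C) by rewrite e in h; lra.
rewrite /A /B /C !big_distrlr /= mulr_sumr -big_split -sumrB /=.
apply: eq_bigr => i _; rewrite mulr_sumr -big_split -sumrB /=.
by apply: eq_bigr => j _; ring.
Qed.

Lemma sqr_sum_le (R : realFieldType) (I : finType) (A : {pred I}) (a : I -> R) :
  (\sum_(i in A) a i) ^+ 2 <= #|A|%:R * \sum_(i in A) a i ^+ 2.
Proof.
have w0 i : (0 : R) <= (i \in A)%:R by rewrite ler0n.
have e (F : I -> R) : \sum_(i in A) F i = \sum_i (i \in A)%:R * F i.
  by rewrite big_mkcond; apply: eq_bigr => i _; case: (i \in A); rewrite ?mul1r ?mul0r.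
have := @cauchy_schwarz_sum R I (fun i => (i \in A)%:R) a (fun=> 1) w0.
under eq_bigr do rewrite mulr1.
under [X in _ * X]eq_bigr do rewrite expr1n.
by rewrite -!e sumr_const -[1 *+ _]/(#|A|%:R) mulrC.
Qed.

(** * One step of the lazy walk *)

Section OneStep.
Context {R : realType} {V : finType}.
Implicit Types (G : sgraph V) (f : V -> R) (pi : V -> R).

Definition lazy_op G f (x : V) : R := \sum_y lazy G x y * f y.

(** Each edge counts twice: with $\pi(x) = c\, d_x$, the Dirichlet form of the lazy
walk is $c/4$ times this. *)
Definition edge_energy G f : R :=
  \sum_x \sum_(y | adj G x y) (f x - f y) ^+ 2.

(** The square of $\|f - 1\|_{2,\pi}$: the variance of $f$ under $\pi$ when $f$ has
mean 1. *)
Definition pi_variance pi f : R := \sum_x pi x * (f x - 1) ^+ 2.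

Lemma edge_energy_ge0 G f : 0 <= edge_energy G f.
Proof. by apply: sumr_ge0 => x _; apply: sumr_ge0 => y _; exact: sqr_ge0. Qed.

Lemma pi_variance_ge0 pi f : (forall x, 0 <= pi x) -> 0 <= pi_variance pi f.
Proof. by move=> pi0; apply: sumr_ge0 => x _; rewrite mulr_ge0 ?sqr_ge0. Qed.

Lemma sum_adj_swap G (F : V -> V -> R) :
  \sum_x \sum_(y | adj G x y) F x y = \sum_x \sum_(y | adj G x y) F y x.
Proof.
rewrite (exchange_big_dep predT) //=; apply: eq_bigr => x _.
by apply: eq_bigl => y; exact: adj_sym.
Qed.

Lemma sum_adj_diff G f : \sum_x \sum_(y | adj G x y) (f y - f x) = 0.
Proof.
set s := LHS; suff : s = - s by move=> h; lra.
rewrite {1}/s sum_adj_swap -sumrN; apply: eq_bigr => x _.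
by rewrite -sumrN; apply: eq_bigr => y _; rewrite opprB.
Qed.

(** Summation by parts: average the left-hand side with its image under the
exchange of $x$ and $y$. *)
Lemma green_identity G f :
  \sum_x f x * \sum_(y | adj G x y) (f y - f x) = - (edge_energy G f / 2).
Proof.
under eq_bigr do rewrite mulr_sumr.
set s := LHS.
suff : s + s = - edge_energy G f by move=> h; lra.
rewrite {1}/s sum_adj_swap /edge_energy -sumrN /s -big_split /=.
apply: eq_bigr => x _; rewrite -sumrN -big_split /=.
by apply: eq_bigr => y _; ring.
Qed.

Lemma sum_adj1 G x (a : R) : \sum_(y | adj G x y) a = (degree G x)%:R * a.
Proof. by rewrite sumr_const mulr_natl /degree cardsE. Qed.

Lemma lazy_sum G x f :
  \sum_y lazy G x y * f y
    = f x / 2 + (2 * (degree G x)%:R)^-1 * \sum_(y | adj G x y) f y.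
Proof.
rewrite (bigD1 x) //= /lazy eqxx; congr (_ + _); first by ring.
rewrite mulr_sumr [RHS]big_mkcond [LHS]big_mkcond.
apply: eq_bigr => y _; rewrite eq_sym; case: (eqVneq x y) => [<-|_] /=.
  by rewrite adj_irr.
by case: ifP => _; rewrite ?mul0r // mul1r.
Qed.

Lemma lazy_ge0 G x y : 0 <= lazy G x y :> R.
Proof.
by rewrite /lazy; case: ifP => _; [lra|case: ifP => _ //];
  rewrite divr_ge0 // mulr_ge0.
Qed.

Lemma degree_gt0 G x : (1 < #|V|)%N -> connected_graph G -> (0 < degree G x)%N.
Proof.
move=> V2 cG; have [y yx] : exists y, y != x.
  have /card_gt0P[y] : (0 < #|predC1 x|)%N by rewrite cardC1 -subn1 subn_gt0.
  by rewrite !inE => yx; exists y.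
have /connectP[[|z p] /= ] := cG x y; first by move=> _ e; rewrite e eqxx in yx.
by case/andP=> xz _ _; apply/card_gt0P; exists z; rewrite inE.
Qed.

Lemma lazy_op_laplacian G f x : (0 < degree G x)%N ->
  lazy_op G f x
    = f x + (2 * (degree G x)%:R)^-1 * \sum_(y | adj G x y) (f y - f x).
Proof.
move=> dx; have d0 : (degree G x)%:R != 0 :> R by rewrite pnatr_eq0 -lt0n.
rewrite /lazy_op lazy_sum big_split /= sum_adj1; field.
by rewrite d0.
Qed.

Lemma lazy_op_ge0 G f : (forall x, 0 <= f x) -> forall x, 0 <= lazy_op G f x.
Proof. by move=> f0 x; apply: sumr_ge0 => y _; rewrite mulr_ge0 ?lazy_ge0. Qed.

Lemma connected_const (T : Type) G (h : V -> T) : connected_graph G ->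
  (forall x y, adj G x y -> h x = h y) -> forall x y, h x = h y.
Proof.
move=> cG hadj x y; have /connectP[p] := cG x y.
elim: p x => [|z p ih] x /=; first by move=> _ ->.
by case/andP=> xz zp e; rewrite (hadj _ _ xz); exact: ih.
Qed.

(** With $h = \pi/d$, stationarity says that the sum of $h(y) - h(x)$ over the
neighbours $y$ of $x$ vanishes for every $x$. By Green's identity $h$ has zero
energy, so it is constant on a connected graph. *)
Lemma stationary_degree G pi : (1 < #|V|)%N -> connected_graph G ->
    stationary pi G ->
  exists2 c : R, 0 < c & forall x, pi x = c * (degree G x)%:R.
Proof.
move=> V2 cG [[pi0 pi1] st].
have d0 x : (degree G x)%:R != 0 :> R by rewrite pnatr_eq0 -lt0n degree_gt0.
pose h x := pi x / (degree G x)%:R.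
have har x : \sum_(y | adj G x y) (h y - h x) = 0.
  have e : \sum_u pi u * lazy G u x = pi x / 2 + (\sum_(y | adj G x y) h y) / 2.
    rewrite (bigD1 x) //= /lazy eqxx; congr (_ + _); first by ring.
    rewrite mulr_suml [RHS]big_mkcond [LHS]big_mkcond.
    apply: eq_bigr => y _; rewrite adj_sym; case: (eqVneq y x) => [<-|_] /=.
      by rewrite adj_irr.
    by case: ifP => _; rewrite ?mulr0 // /h; field; rewrite d0.
  have hx : (degree G x)%:R * h x = pi x by rewrite /h; field; rewrite d0.
  rewrite big_split /= sum_adj1 mulrN hx.
  by have := st x; rewrite e => {hx} ?; lra.
have E0 : edge_energy G h = 0.
  have := green_identity G h.
  under eq_bigr do rewrite har mulr0.
  by rewrite big1 // => ?; lra.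
have hc : forall x y, h x = h y.
  apply: (@connected_const _ G) => // x y xy.
  have Ex : \sum_(z | adj G x z) (h x - h z) ^+ 2 = 0.
    apply: (psumr_eq0P _ E0) => // z _.
    by apply: sumr_ge0 => w _; exact: sqr_ge0.
  have /eqP := psumr_eq0P (fun z _ => sqr_ge0 (h x - h z)) Ex xy.
  by rewrite sqrf_eq0 subr_eq0 => /eqP.
have /card_gt0P[x0 _] : (0 < #|V|)%N by apply: leq_trans V2.
have pic x : pi x = h x0 * (degree G x)%:R.
  by rewrite (hc x0 x) /h; field; rewrite d0.
exists (h x0) => //; rewrite lt_neqAle divr_ge0 ?ler0n // andbT.
apply/eqP => e; move: pi1; rewrite big1 => [/esym/eqP|x _].
  by rewrite oner_eq0.
by rewrite pic -e mul0r.
Qed.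

Section Stationary.
Variables (G : sgraph V) (pi : V -> R) (c : R).
Hypotheses (degG : forall x, (0 < degree G x)%N) (c0 : 0 < c)
  (piE : forall x, pi x = c * (degree G x)%:R).

Let d0 x : (degree G x)%:R != 0 :> R.
Proof. by rewrite pnatr_eq0 -lt0n. Qed.

Lemma pi_lazy_op f x :
  pi x * lazy_op G f x
    = pi x * f x + c / 2 * \sum_(y | adj G x y) (f y - f x).
Proof. by rewrite lazy_op_laplacian // piE; field; rewrite d0. Qed.

Lemma sum_pi_lazy_op f : \sum_x pi x * lazy_op G f x = \sum_x pi x * f x.
Proof.
under eq_bigr do rewrite pi_lazy_op.
by rewrite big_split /= -mulr_sumr sum_adj_diff mulr0 addr0.
Qed.

(** Write $s(x)$ for the sum of $f(y) - f(x)$ over the neighbours of $x$. Since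
$Pf = f + s/(2d)$, the cross term of the square contributes $-(c/2)D(f)$ by Green's
identity, and Cauchy-Schwarz bounds $s(x)^2/d_x$ so that the remaining term gives
back at most $(c/4) D(f)$. The factor $1/2$ of the lazy step is what makes the sum
negative. *)
Lemma variance_lazy_op f :
  pi_variance pi (lazy_op G f) <= pi_variance pi f - c / 4 * edge_energy G f.
Proof.
pose s x := \sum_(y | adj G x y) (f y - f x).
have step x : pi x * (lazy_op G f x - 1) ^+ 2 <=
    pi x * (f x - 1) ^+ 2 + c * (f x * s x - s x)
      + c / 4 * \sum_(y | adj G x y) (f x - f y) ^+ 2.
  have : s x ^+ 2 <= (degree G x)%:R * \sum_(y | adj G x y) (f x - f y) ^+ 2.
    have := @sqr_sum_le R V [set y | adj G x y] (fun y => f y - f x).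
    rewrite -/(degree G x).
    under eq_bigl do rewrite inE.
    under [X in _ <= _ * X]eq_bigl do rewrite inE.
    by under [X in _ <= _ * X]eq_bigr do rewrite -sqrrN opprB.
  have := d0 x; have : 0 <= (degree G x)%:R :> R by rewrite ler0n.
  rewrite lazy_op_laplacian // piE -/(s x).
  set d := (degree G x)%:R; set q := \sum_(y | _) _; set t := s x => dge dn h.
  have -> : c * d * (f x + (2 * d)^-1 * t - 1) ^+ 2 =
     c * d * (f x - 1) ^+ 2 + c * (f x * t - t) + c / 4 * (t ^+ 2 / d).
    by field; rewrite dn.
  rewrite lerD2l ler_wpM2l ?divr_ge0 ?(ltW c0) //.
  by rewrite ler_pdivrMr ?lt_def ?dn // mulrC.
apply: le_trans (ler_sum _ (fun x _ => step x)) _.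
rewrite !big_split /= -!mulr_sumr sumrB green_identity sum_adj_diff subr0.
rewrite -/(edge_energy G f) /pi_variance; lra.
Qed.

End Stationary.
End OneStep.

(** * Shortest paths and the energy across a level *)

Section Distance.
Context {V : finType}.
Variables (G : sgraph V) (x0 : V).
Hypothesis cG : connected_graph G.

(** The distance from $x_0$, through the three properties that are used of it. *)
Lemma graph_distance : exists l : V -> nat,
  [/\ forall y, l y = 0%N -> y = x0,
      forall x y, adj G x y -> (l y <= (l x).+1)%N
    & forall y k, l y = k.+1 -> exists2 x, adj G x y & l x = k].
Proof.
pose walk y k := exists p, [/\ path (adj G) x0 p, last x0 p = y & size p = k].
have /boolp.choice[l lP] y : exists l, walk y l /\ forall k, walk y k -> (l <= k)%N.
  have ex : exists k, `[< walk y k >].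
    have /connectP[p px py] := cG x0 y.
    by exists (size p); apply/asboolP; exists p.
  exists (ex_minn ex); case: ex_minnP => k /asboolP wk kmin.
  by split=> // j /asboolP; exact: kmin.
have lip x y : adj G x y -> (l y <= (l x).+1)%N.
  move=> xy; have [[p [px lx sx]] _] := lP x.
  apply: (lP y).2; exists (rcons p y).
  by rewrite rcons_path last_rcons size_rcons px lx xy sx.
exists l; split=> // [y ly|y k ly].
  have [[p [_ py sp]] _] := lP y.
  by move: sp py; rewrite ly => /size0nil ->.
have [[p []]] := lP y; case/lastP: p => [|p z]; first by rewrite ly.
rewrite rcons_path last_rcons size_rcons ly => /andP[px xz] zy [sp] _.
exists (last x0 p); first by rewrite -zy.
have kz : (k <= l (last x0 p))%N by rewrite -ltnS -ly -zy; exact: lip.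
by apply/eqP; rewrite eqn_leq kz andbT; apply: (lP _).2; exists p.
Qed.

Lemma geodesic (l : V -> nat) :
    (forall y k, l y = k.+1 -> exists2 x, adj G x y & l x = k) ->
  forall k y, l y = k -> exists x : nat -> V,
    [/\ x k = y, forall i, (i <= k)%N -> l (x i) = i
      & forall i, (i < k)%N -> adj G (x i) (x i.+1)].
Proof.
move=> lS; elim=> [|k ih] y ly.
  by exists (fun=> y); split=> // i; rewrite leqn0 => /eqP ->.
have [z zy lz] := lS _ _ ly; have [x [xk xl xadj]] := ih _ lz.
exists (fun i => if (i <= k)%N then x i else y); split.
- by rewrite ltnn.
- move=> i; rewrite leq_eqVlt => /predU1P[->|]; first by rewrite ltnn.
  by rewrite ltnS => ik; rewrite ik xl.
- move=> i; rewrite ltnS => ik1; have /predU1P[->|ik] : (i == k) || (i < k)%N.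
      by rewrite -leq_eqVlt.
    by rewrite /= leqnn ltnn xk.
  by rewrite /= (ltnW ik) ik; exact: xadj.
Qed.

End Distance.

(** The window $\{l-1, l, l+1\}$ holds at most three indices: a vertex is adjacent to
at most three vertices of a geodesic. *)
Lemma sum_window n l :
  (\sum_(i < n) ((i <= l.+1) && (l <= i.+1))%N <= 3)%N.
Proof.
have one k : (\sum_(i < n) (i == k :> nat) <= 1)%N.
  suff -> : (\sum_(i < n) (i == k :> nat) = (k < n))%N by case: (k < n)%N.
  elim: n => [|n ih]; first by rewrite big_ord0.
  by rewrite big_ord_recr /= ih; lia.
apply: leq_trans (leq_add (leq_add (one l.-1) (one l)) (one l.+1)).
rewrite -!big_split /=; apply: leq_sum => i _; lia.
Qed.

Section Cut.
Context {R : realType} {V : finType}.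

Lemma sum_geodesic_le (l : V -> nat) (x : nat -> V) k (g : V -> R) :
    (forall i, (i <= k)%N -> l (x i) = i) -> (forall z, 0 <= g z) ->
  \sum_(i < k) g (x i) <= \sum_z g z.
Proof.
move=> xl g0.
have inj : {in 'I_k &, injective (fun i : 'I_k => x i)}.
  move=> i j _ _ e; apply: val_inj; rewrite /=.
  by rewrite -(xl i (ltnW (ltn_ord i))) e (xl j (ltnW (ltn_ord j))).
rewrite -(big_imset g inj) /=.
by rewrite [leLHS]big_mkcond /=; apply: ler_sum => z _; case: ifP.
Qed.

(** If half of the neighbours of $x_0$ lie outside $S = \{f > a\}$, the edges to them
carry enough energy. Otherwise $\delta \le 2|S|$; take a shortest path
$x_0, \dots, x_L$ out of $S$. All neighbours of $x_i$ with $i \le L-2$ lie in $S$, and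
each vertex of $S$ is adjacent to at most three $x_i$, so $\delta(L-1) \le 3|S|$ and
$\delta L \le 5|S|$. Cauchy-Schwarz along the path, whose edges are distinct, gives
$(f(x_0) - a)^2 \le L D(f)$. *)
Lemma edge_energy_cut (G : sgraph V) (f : V -> R) x0 (a dl : R) :
    connected_graph G -> 0 <= dl -> (forall x, dl <= (degree G x)%:R) ->
    a < f x0 -> (exists y, f y <= a) ->
  dl * (f x0 - a) ^+ 2 <= 5 * #|[set x | a < f x]|%:R * edge_energy G f.
Proof.
move=> cG dl0 dlG ax0 [y0 y0a]; set S := [set x | a < f x].
have x0S : x0 \in S by rewrite inE.
have S1 : 1 <= #|S|%:R :> R.
  by rewrite ler1n; apply/card_gt0P; exists x0.
have D0 := edge_energy_ge0 G f; set D := edge_energy G f in D0 *.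
set Dl2 := (f x0 - a) ^+ 2; have Dl20 : 0 <= Dl2 by exact: sqr_ge0.
pose N x := [set y | adj G x y].
have degN : degree G x0 = (#|N x0 :&: S| + #|N x0 :\: S|)%N by rewrite cardsID.
case: (leqP (degree G x0) (2 * #|N x0 :\: S|)%N) => [outN|inN].
  have outD : #|N x0 :\: S|%:R * Dl2 <= D.
    apply: (@le_trans _ _ (\sum_(y | adj G x0 y) (f x0 - f y) ^+ 2)).
      rewrite mulr_natl -sumr_const big_mkcond [leRHS]big_mkcond /=.
      apply: ler_sum => y _; rewrite !inE; case: (adj G x0 y); rewrite ?andbF //.
      rewrite andbT -leNgt; case: ifP => [ya|_]; last exact: sqr_ge0.
      by rewrite ler_sqr ?nnegrE; lra.
    rewrite /D /edge_energy [leRHS](bigD1 x0) //= lerDl; apply: sumr_ge0 => x _.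
    by apply: sumr_ge0 => y _; exact: sqr_ge0.
  have : dl <= 2 * #|N x0 :\: S|%:R.
    by apply: le_trans (dlG x0) _; rewrite -natrM ler_nat.
  by move=> h; nra.
have [l [l0 llip lS]] := graph_distance x0 cG.
have y0S : y0 \notin S by rewrite inE -leNgt.
have [/= ys ysS ysmin] := arg_minnP (P := fun y => y \notin S) l y0S.
have inS y : (l y < l ys)%N -> y \in S.
  by apply: contraLR => /ysmin; rewrite -leqNgt.
have [x [xL xl xadj]] := geodesic lS (erefl (l ys)).
set L := l ys in inS xL xl xadj.
have xx0 : x 0%N = x0 by apply: l0; exact: xl.
have L0 : (0 < L)%N.
  by rewrite lt0n; apply: contraNneq ysS => /l0 ->.
(* the neighbours of the last two vertices of the path may lie outside S *)
have count : (\sum_(i < L.-1) degree G (x i) <= 3 * #|S|)%N.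
  apply: (@leq_trans (\sum_(i < L.-1) \sum_(y in S) adj G (x i) y)).
    apply: leq_sum => i _; rewrite /degree -sum1_card big_mkcond /=.
    rewrite [leqRHS]big_mkcond /=; apply: leq_sum => y _.
    rewrite !inE; case: ifP => // xy; suff : y \in S by rewrite inE => ->.
    apply: inS.
    have iL : (i.+1 < L)%N by have := ltn_ord i; rewrite -ltnS (prednK L0).
    by apply: leq_ltn_trans (llip _ _ xy) _; rewrite xl // ltnW // ltnW.
  rewrite exchange_big /= mulnC -sum_nat_const; apply: leq_sum => y _.
  apply: leq_trans (sum_window L.-1 (l y)); apply: leq_sum => i _.
  case: (boolP (adj G (x i) y)) => // xy.
  have xi : l (x i) = i.
    by apply: xl; rewrite ltnW // (leq_trans (ltn_ord i)) // leq_pred.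
  have := llip _ _ xy; rewrite adj_sym in xy; have := llip _ _ xy.
  by rewrite xi => -> ->.
have dlL : dl * L%:R <= 5 * #|S|%:R.
  have h1 : dl * L.-1%:R <= 3 * #|S|%:R.
    apply: (@le_trans _ _ (\sum_(i < L.-1) (degree G (x i))%:R)).
      by rewrite mulr_natr -[X in _ *+ X]card_ord -sumr_const; apply: ler_sum.
    by rewrite -natr_sum -natrM ler_nat.
  have h2 : dl <= 2 * #|S|%:R.
    apply: le_trans (dlG x0) _; rewrite -natrM ler_nat degN.
    have : (#|N x0 :&: S| <= #|S|)%N by apply: subset_leq_card; exact: subsetIr.
    by move: inN; rewrite degN; clear; lia.
  rewrite -(prednK L0) -natr1; lra.
have tel : f x0 - f ys = \sum_(i < L) (f (x i) - f (x i.+1)).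
  rewrite -(big_mkord xpredT (fun i => f (x i) - f (x i.+1))).
  rewrite -xx0 -xL -opprB -(telescope_sumr (fun i => f (x i)) (leq0n L)) -sumrN.
  by apply: eq_bigr => i _; rewrite opprB.
have ysa : f ys <= a by move: ysS; rewrite inE -leNgt.
have Dl2L : Dl2 <= L%:R * D.
  apply: (@le_trans _ _ ((f x0 - f ys) ^+ 2)).
    by rewrite ler_sqr ?nnegrE; lra.
  rewrite tel.
  apply: le_trans (sqr_sum_le xpredT _) _; rewrite card_ord ler_wpM2l //.
  have g0 z : 0 <= \sum_(y | adj G z y) (f z - f y) ^+ 2.
    by apply: sumr_ge0 => y _; exact: sqr_ge0.
  apply: le_trans (sum_geodesic_le xl g0); apply: ler_sum => i _.
  rewrite (bigD1 (x i.+1)) ?xadj //= lerDl; apply: sumr_ge0 => y _.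
  exact: sqr_ge0.
apply: (@le_trans _ _ (dl * L%:R * D)); last by rewrite ler_wpM2r.
by rewrite -mulrA ler_wpM2l.
Qed.
End Cut.

(** * Decay of the variance *)

Section Decay.
Context {R : realType} {V : finType}.
Variables (pi : V -> R) (p : R).
Hypotheses (V2 : (1 < #|V|)%N) (p0 : 0 < p) (ppi : forall x, p <= pi x)
  (pi1 : \sum_x pi x = 1).

Definition density (f : V -> R) : Prop :=
  (forall x, 0 <= f x) /\ \sum_x pi x * f x = 1.

Let pi0 x : 0 < pi x. Proof. exact: lt_le_trans p0 (ppi x). Qed.

Lemma card_pi_le1 : #|V|%:R * p <= 1.
Proof.
by rewrite -[leRHS]pi1 mulr_natl -sumr_const; apply: ler_sum.
Qed.

Lemma density_min f : density f -> exists y, f y <= 1.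
Proof.
move=> [f0 f1]; apply: contrapT => /forallNP h.
suff : \sum_x pi x < \sum_x pi x * f x by rewrite pi1 f1 ltxx.
have /card_gt0P[x0 _] : (0 < #|V|)%N by apply: leq_trans V2.
have ge x : pi x <= pi x * f x.
  by rewrite ler_peMr ?(ltW (pi0 x)) // ltW // ltNge; apply/negP/h.
rewrite (bigD1 x0) //= [ltRHS](bigD1 x0) //=; apply: ltr_leD.
  by rewrite ltr_pMr // ltNge; apply/negP/h.
exact: ler_sum.
Qed.

(** The mean of $f^2$ is $1 + v$, and it is at most $\max f$ because $f$ has mean 1. *)
Lemma density_max f : density f -> exists x0, pi_variance pi f + 1 <= f x0.
Proof.
move=> [f0 f1]; have /card_gt0P[x1 _] : (0 < #|V|)%N by apply: leq_trans V2.
have [/= x0 _ xmax] := arg_maxP (P := xpredT) f (i0 := x1) isT.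
exists x0.
have -> : pi_variance pi f + 1 = \sum_x pi x * f x ^+ 2.
  have -> : \sum_x pi x * f x ^+ 2
      = \sum_x (pi x * (f x - 1) ^+ 2 + (2 * (pi x * f x) - pi x)).
    by apply: eq_bigr => x _; ring.
  by rewrite !big_split /= sumrN -mulr_sumr f1 pi1 /pi_variance; lra.
rewrite -[leRHS]mulr1 -[X in _ * X]f1 mulr_sumr.
apply: ler_sum => x _; rewrite expr2 mulrCA.
by apply: ler_wpM2r; [rewrite mulr_ge0 // ltW | exact: xmax].
Qed.

Section Step.
Variables (G : sgraph V) (f : V -> R).
Hypotheses (cG : connected_graph G) (stG : stationary pi G) (df : density f).

Let degG x : (0 < degree G x)%N := degree_gt0 x V2 cG.

Lemma density_lazy_op : density (lazy_op G f).
Proof.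
have [c c0 piE] := stationary_degree V2 cG stG; have [f0 f1] := df.
by split; [exact: lazy_op_ge0|rewrite (sum_pi_lazy_op degG piE)].
Qed.

(** Cut at the minimum of $f$: since $\max f - \min f \ge v$ and the level set has at
most $n$ vertices, the energy is at least of order $v^2$. The decay is quadratic in
$v$, not linear, and this makes the mixing time free of a logarithm of the initial
variance. *)
Lemma variance_decay_poincare :
  pi_variance pi (lazy_op G f)
    <= pi_variance pi f - p / (20 * #|V|%:R) * pi_variance pi f ^+ 2.
Proof.
set v := pi_variance pi f.
have [c c0 piE] := stationary_degree V2 cG stG.
apply: le_trans (variance_lazy_op degG c0 piE f) _; rewrite -/v lerD2l lerN2.
have n0 : 0 < #|V|%:R :> R by rewrite ltr0n ltnW.
have v0 : 0 <= v by apply: pi_variance_ge0 => x; exact: ltW.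
have D0 := edge_energy_ge0 G f; set D := edge_energy G f in D0 *.
have [->|vn0] := eqVneq v 0; first by rewrite expr0n mulr0 mulr_ge0 // divr_ge0 ?ltW.
have vgt0 : 0 < v by rewrite lt_def vn0.
have [y y1] := density_min df; have [x0] := density_max df.
rewrite -/v => x0v; have yx0 : f y < f x0 by lra.
have dl0 : 0 <= p / c by rewrite divr_ge0 ?ltW.
have dlG x : p / c <= (degree G x)%:R.
  by rewrite ler_pdivrMr // mulrC -piE.
have := @edge_energy_cut R V G f x0 (f y) (p / c) cG dl0 dlG yx0 (ex_intro _ y (lexx _)).
set S := [set x | _]; rewrite -/D => h.
have Sn : #|S|%:R <= #|V|%:R :> R by rewrite ler_nat max_card.
have h2 : p / c * v ^+ 2 <= 5 * #|V|%:R * D.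
  apply: (@le_trans _ _ (p / c * (f x0 - f y) ^+ 2)).
    by rewrite ler_wpM2l // ler_sqr ?nnegrE //; lra.
  by apply: le_trans h _; rewrite ler_wpM2r // ler_wpM2l.
have -> : p / (20 * #|V|%:R) * v ^+ 2 = c / 4 * (p / c * v ^+ 2 / (5 * #|V|%:R)).
  by field; rewrite !gt_eqF.
rewrite ler_wpM2l ?divr_ge0 ?(ltW c0) //.
by rewrite ler_pdivrMr ?mulr_gt0 // [leRHS]mulrC.
Qed.

(** A Nash-type inequality. For $v > 1$ cut at half of $M = \max f \ge 2$: the level set has
at most $2/(pM)$ vertices. For $v \le 1$ the quadratic decay is already stronger,
because $np \le 1$. *)
Lemma variance_decay_nash :
  pi_variance pi (lazy_op G f)
    <= pi_variance pi f - p ^+ 2 / 160 * pi_variance pi f ^+ 3.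
Proof.
set v := pi_variance pi f.
have n0 : 0 < #|V|%:R :> R by rewrite ltr0n ltnW.
have v0 : 0 <= v by apply: pi_variance_ge0 => x; exact: ltW.
have [v1|v1] := lerP v 1.
  apply: le_trans variance_decay_poincare _; rewrite -/v lerD2l lerN2.
  have := card_pi_le1; set n := #|V|%:R in n0 * => np.
  have -> : p / (20 * n) * v ^+ 2 = p * v ^+ 2 * (1 / (20 * n)).
    by field; rewrite gt_eqF.
  have -> : p ^+ 2 / 160 * v ^+ 3 = p * v ^+ 2 * (p * v / 160) by field.
  rewrite ler_wpM2l ?mulr_ge0 ?sqr_ge0 ?(ltW p0) //.
  rewrite ler_pdivlMr ?mulr_gt0 //.
  have : n * p * v <= 1 * 1 by apply: ler_pM => //; rewrite mulr_ge0 ?ltW.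
  lra.
have [c c0 piE] := stationary_degree V2 cG stG.
apply: le_trans (variance_lazy_op degG c0 piE f) _; rewrite -/v lerD2l lerN2.
have D0 := edge_energy_ge0 G f; set D := edge_energy G f in D0 *.
have [y y1] := density_min df; have [x0] := density_max df.
rewrite -/v; set M := f x0 => x0v; have yM : f y <= M / 2 by lra.
have M2M : M / 2 < M by lra.
have dl0 : 0 <= p / c by rewrite divr_ge0 ?ltW.
have dlG x : p / c <= (degree G x)%:R.
  by rewrite ler_pdivrMr // mulrC -piE.
have := @edge_energy_cut R V G f x0 (M / 2) (p / c) cG dl0 dlG M2M (ex_intro _ y yM).
set S := [set x | _]; rewrite -/D -/M => h.
(* Markov's inequality *)
have SM : p * #|S|%:R * (M / 2) <= 1.
  have [f0 f1] := df; rewrite -[leRHS]f1 mulrAC mulr_natr -sumr_const.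
  rewrite [leLHS]big_mkcond /=; apply: ler_sum => x _.
  case: ifP => [|_]; last by rewrite mulr_ge0 // ltW.
  by rewrite inE => ?; apply: ler_pM; rewrite ?(ltW p0) //; lra.
have h2 : p * (M / 2) ^+ 2 <= 5 * #|S|%:R * D * c.
  move: h; rewrite mulrAC ler_pdivrMr //.
  by have -> : M - M / 2 = M / 2 by field.
have h3 : p ^+ 2 * M ^+ 3 <= 40 * (c * D).
  have : p * (M / 2) ^+ 2 * (8 * (p * (M / 2))) <= 5 * #|S|%:R * D * c * (8 * (p * (M / 2))).
    by rewrite ler_wpM2r // !mulr_ge0 ?(ltW p0) //; lra.
  have -> : p * (M / 2) ^+ 2 * (8 * (p * (M / 2))) = p ^+ 2 * M ^+ 3 by field.
  move/le_trans; apply.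
  have -> : 5 * #|S|%:R * D * c * (8 * (p * (M / 2)))
     = 40 * (c * D) * (p * #|S|%:R * (M / 2)) by ring.
  by rewrite ler_piMr // !mulr_ge0 // ltW.
have : p ^+ 2 * v ^+ 3 <= p ^+ 2 * M ^+ 3.
  by rewrite ler_wpM2l ?sqr_ge0 // lerXn2r ?nnegrE //; lra.
lra.
Qed.

End Step.

(** The density with respect to $\pi$ of the point mass at $u$. *)
Definition dirac_density (u x : V) : R := (u == x)%:R / pi x.

Lemma dirac_densityP u : density (dirac_density u).
Proof.
split=> [x|]; first by rewrite divr_ge0 ?ler0n ?ltW.
rewrite (bigD1 u) //= /dirac_density eqxx mul1r divff ?gt_eqF //.
rewrite big1 ?addr0 // => x xu.
by rewrite eq_sym (negPf xu) mul0r mulr0.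
Qed.

Lemma variance_dirac u : pi_variance pi (dirac_density u) <= p^-1.
Proof.
have [x hx] := density_max (dirac_densityP u).
have : dirac_density u x <= p^-1.
  rewrite /dirac_density; case: eqP => _; last by rewrite mul0r invr_ge0 ltW.
  by rewrite mul1r lef_pV2 ?posrE.
lra.
Qed.

(** The graphs are arbitrary here, so that the results apply both to the walk and to
its time reversal. *)
Section Evolution.
Variables (Gs : nat -> sgraph V) (F : nat -> V -> R) (u : V).
Hypotheses (cG : forall i, connected_graph (Gs i))
  (stG : forall i, stationary pi (Gs i))
  (F0 : F 0%N = dirac_density u)
  (FS : forall i, F i.+1 = lazy_op (Gs i) (F i)).

Lemma density_evolution i : density (F i).
Proof.
elim: i => [|i ih]; first by rewrite F0; exact: dirac_densityP.
by rewrite FS; exact: density_lazy_op.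
Qed.

Let v i := pi_variance pi (F i).

Let v0 i : 0 <= v i.
Proof. by apply: pi_variance_ge0 => x; exact: ltW. Qed.

(** $1/v_i$ grows by at least $p/(20n)$ in each step. *)
Lemma variance_evolution_mixing i :
  pi_variance pi (F i) * (p * i.+1%:R) <= 20 * #|V|%:R.
Proof.
have n0 : 0 < #|V|%:R :> R by rewrite ltr0n ltnW.
pose c := p / (20 * #|V|%:R); have c0 : 0 < c by rewrite divr_gt0 ?mulr_gt0.
suff h : v i * c * i.+1%:R <= 1.
  move: h; rewrite /c; have -> : v i * (p / (20 * #|V|%:R)) * i.+1%:R
    = v i * (p * i.+1%:R) / (20 * #|V|%:R) by field; rewrite gt_eqF.
  by rewrite ler_pdivrMr ?mulr_gt0 // mul1r.
elim: i => [|i ih].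
  rewrite mulr1 /v F0.
  apply: (@le_trans _ _ (p^-1 * c)).
    by rewrite ler_wpM2r ?(ltW c0) //; exact: variance_dirac.
  have -> : p^-1 * c = (20 * #|V|%:R)^-1 by rewrite /c; field; rewrite !gt_eqF.
  rewrite invf_le1 ?mulr_gt0 //.
  have : 1 <= #|V|%:R :> R by rewrite ler1n ltnW.
  lra.
have := variance_decay_poincare (cG i) (stG i) (density_evolution i).
rewrite -FS -/(v i.+1) -/(v i) -/c => /= dec.
have y0 := v0 i.+1; have x0 := v0 i; set y := v i.+1 in dec y0 *.
set x := v i in dec x0 ih *; rewrite -natr1; set k := i.+1%:R in ih *.
have k0 : 0 <= k by rewrite /k.
have a1 : x * c <= 1.
  rewrite leNgt; apply/negP => xc.
  have : x * (x * c - 1) > 0.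
    rewrite mulr_gt0 ?subr_gt0 // lt_def x0 andbT.
    by apply: contraTneq xc => ->; rewrite mul0r -leNgt.
  nra.
have a0 : 0 <= x * c by rewrite mulr_ge0 // ltW.
apply: (@le_trans _ _ ((x - c * x ^+ 2) * c * (k + 1))).
  by rewrite !ler_wpM2r ?addr_ge0 // ltW.
have -> : (x - c * x ^+ 2) * c * (k + 1) = (1 - x * c) * (x * c * k + x * c) by ring.
nra.
Qed.

(** $1/v_i^2$ grows by at least $p^2/160$ in each step. *)
Lemma variance_evolution_nash i :
  pi_variance pi (F i) ^+ 2 * (p ^+ 2 * i.+1%:R) <= 160.
Proof.
pose c := p ^+ 2 / 160; have c0 : 0 < c by rewrite divr_gt0 ?exprn_gt0.
suff h : v i ^+ 2 * c * i.+1%:R <= 1 by rewrite -/(v i); rewrite /c in h; lra.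
elim: i => [|i ih].
  rewrite mulr1 /v F0.
  apply: (@le_trans _ _ (p^-1 ^+ 2 * c)).
    rewrite ler_wpM2r ?(ltW c0) // lerXn2r ?nnegrE ?invr_ge0 ?(ltW p0) //.
      by rewrite -F0; exact: v0.
    exact: variance_dirac.
  have -> : p^-1 ^+ 2 * c = 160^-1 by rewrite /c; field; rewrite gt_eqF.
  lra.
have := variance_decay_nash (cG i) (stG i) (density_evolution i).
rewrite -FS -/(v i.+1) -/(v i) -/c => /= dec.
have y0 := v0 i.+1; have x0 := v0 i; set y := v i.+1 in dec y0 *.
set x := v i in dec x0 ih *; rewrite -natr1; set k := i.+1%:R in ih *.
have k0 : 0 <= k by rewrite /k.
set a := x ^+ 2 * c.
have a0 : 0 <= a by rewrite mulr_ge0 ?sqr_ge0 // ltW.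
have dec' : y <= x * (1 - a) by rewrite /a; apply: le_trans dec _; lra.
have a1 : a <= 1.
  rewrite leNgt; apply/negP => xc.
  have xn : 0 < x.
    rewrite lt_def x0 andbT; apply: contraTneq xc => e.
    by rewrite /a e expr0n mul0r -leNgt.
  have : x * (a - 1) > 0 by rewrite mulr_gt0 ?subr_gt0.
  lra.
apply: (@le_trans _ _ ((x * (1 - a)) ^+ 2 * c * (k + 1))).
  by rewrite !ler_wpM2r ?addr_ge0 ?(ltW c0) // lerXn2r ?nnegrE // mulr_ge0 //; lra.
have -> : (x * (1 - a)) ^+ 2 * c * (k + 1) = (1 - a) ^+ 2 * (a * k + a).
  by rewrite /a; ring.
have : (1 - a) ^+ 2 * (a * k + a) <= (1 - a) ^+ 2 * (1 + a).
  by rewrite ler_wpM2l ?sqr_ge0 // lerD2r.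
move/le_trans; apply.
have -> : (1 - a) ^+ 2 * (1 + a) = 1 - a * (1 + a * (1 - a)) by ring.
have a1' : 0 <= 1 - a by lra.
have : 0 <= a * (1 + a * (1 - a)) by rewrite mulr_ge0 // addr_ge0 // mulr_ge0.
lra.
Qed.

End Evolution.
End Decay.

(** * Transition probabilities of the walk *)

Section Kernel.
Context {R : realType} {V : finType}.
Variable G : nat -> sgraph V.
Notation P := (walk_prob (R := R) G).

Lemma walk_prob_refl t u v : P t t u v = (u == v)%:R.
Proof.
by rewrite /walk_prob /walk_mx big_geq // mxE (inj_eq enum_rank_inj).
Qed.

Lemma walk_prob_cat s r t u v : (s <= r <= t)%N ->
  P s t u v = \sum_w P s r u w * P r t w v.
Proof.
case/andP=> sr rt; rewrite /walk_prob /walk_mx (big_cat_nat sr rt) /= mxE.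
exact: (reindex _ (onW_bij _ (enum_rank_bij V))).
Qed.

Lemma walk_prob1 t u v : P t t.+1 u v = lazy (G t.+1) u v.
Proof.
by rewrite /walk_prob /walk_mx big_nat1 mxE !enum_rankK.
Qed.

Lemma walk_prob_first_step s t u v : (s < t)%N ->
  P s t u v = \sum_w lazy (G s.+1) u w * P s.+1 t w v.
Proof.
move=> st; rewrite (@walk_prob_cat s s.+1 t) ?leqnSn //.
by apply: eq_bigr => w _; rewrite walk_prob1.
Qed.

Lemma walk_prob_last_step s t u v : (s <= t)%N ->
  P s t.+1 u v = \sum_w P s t u w * lazy (G t.+1) w v.
Proof.
move=> st; rewrite (@walk_prob_cat s t t.+1) ?leqnSn ?st //.
by apply: eq_bigr => w _; rewrite walk_prob1.
Qed.

Lemma walk_prob_ge0 s t u v : (s <= t)%N -> 0 <= P s t u v.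
Proof.
move=> st; rewrite -(subnKC st); elim: (t - s)%N v => [|k ih] v.
  by rewrite addn0 walk_prob_refl ler0n.
rewrite addnS walk_prob_last_step ?leq_addr //.
by apply: sumr_ge0 => w _; rewrite mulr_ge0 ?lazy_ge0.
Qed.

End Kernel.

Section Mixing.
Context {R : realType} {V : finType}.
Variables (G : nat -> sgraph V) (pi : V -> R) (p : R).
Hypotheses (V2 : (1 < #|V|)%N) (p0 : 0 < p) (ppi : forall x, p <= pi x)
  (cG : forall t, (1 <= t)%N -> connected_graph (G t))
  (stG : forall t, (1 <= t)%N -> stationary pi (G t)).
Notation P := (walk_prob (R := R) G).

Let pi0 x : 0 < pi x. Proof. exact: lt_le_trans p0 (ppi x). Qed.

Let pi1 : \sum_x pi x = 1. Proof. by have [[_ ->]] := stG (leqnn 1). Qed.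

Lemma lazy_reversible t x y : pi x * lazy (G t.+1) x y = pi y * lazy (G t.+1) y x.
Proof.
have [c c0 piE] := stationary_degree V2 (cG (ltn0Sn t)) (stG (ltn0Sn t)).
have d0 z : (degree (G t.+1) z)%:R != 0 :> R.
  by rewrite pnatr_eq0 -lt0n degree_gt0 //; exact: cG.
rewrite /lazy eq_sym; case: eqP => [->//|_]; rewrite adj_sym.
by case: ifP => _; rewrite ?mulr0 // !piE; field; rewrite !d0.
Qed.

Definition forward_density s u i x : R := P s (s + i) u x / pi x.

Lemma forward_density0 s u : forward_density s u 0 = dirac_density pi u.
Proof.
by apply: funext => x; rewrite /forward_density addn0 walk_prob_refl.
Qed.

(** By reversibility, one more step acts on the density as the operator of the step
acts on functions. *)
Lemma forward_densityS s u i :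
  forward_density s u i.+1
    = lazy_op (G (s + i).+1) (forward_density s u i).
Proof.
apply: funext => x; rewrite /forward_density addnS walk_prob_last_step ?leq_addr //.
rewrite mulr_suml; apply: eq_bigr => w _.
have := lazy_reversible (s + i) w x; move: (pi0 w) (pi0 x) => pw px e.
have -> : lazy (G (s + i).+1) w x = pi x * lazy (G (s + i).+1) x w / pi w.
  by rewrite -e; field; rewrite gt_eqF.
by field; rewrite !gt_eqF.
Qed.

(** The step that ends at time $t - i$ uses the graph at this time. The graph at time 1
stands in for $i \ge t$ to make every member of the sequence a connected graph. *)
Definition backward_graph t i := if (i < t)%N then G (t - i) else G 1.

(** Prepending steps to a walk that ends at $v$ at time $t$; up to the factor $\pi(v)$
this is the probability of arriving at $v$, see [backward_densityE]. *)
Definition backward_density t v i : V -> R :=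
  iteri i (fun j f => lazy_op (backward_graph t j) f) (dirac_density pi v).

Lemma backward_densityE t v i x : (i <= t)%N ->
  backward_density t v i x = P (t - i) t x v / pi v.
Proof.
elim: i x => [|i ih] x it.
  rewrite subn0 walk_prob_refl /= /dirac_density eq_sym.
  by case: eqP => [->//|_]; rewrite !mul0r.
rewrite /= /lazy_op /backward_graph it walk_prob_first_step; last by lia.
rewrite -subSn // subSS mulr_suml; apply: eq_bigr => w _.
by rewrite -mulrA -ih // ltnW.
Qed.

Let cG' s i : connected_graph (G (s + i).+1). Proof. exact: cG. Qed.
Let stG' s i : stationary pi (G (s + i).+1). Proof. exact: stG. Qed.
Let cB t i : connected_graph (backward_graph t i).
Proof.
by rewrite /backward_graph; case: ifP => it; apply: cG => //; rewrite subn_gt0.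
Qed.
Let stB t i : stationary pi (backward_graph t i).
Proof.
by rewrite /backward_graph; case: ifP => it; apply: stG => //; rewrite subn_gt0.
Qed.

Lemma forward_mixing s u i :
  pi_variance pi (forward_density s u i) * (p * i.+1%:R) <= 20 * #|V|%:R.
Proof.
exact: (variance_evolution_mixing V2 p0 ppi pi1 (cG' s) (stG' s)
  (forward_density0 s u) (forward_densityS s u)).
Qed.

Lemma forward_nash s u i :
  pi_variance pi (forward_density s u i) ^+ 2 * (p ^+ 2 * i.+1%:R) <= 160.
Proof.
exact: (variance_evolution_nash V2 p0 ppi pi1 (cG' s) (stG' s)
  (forward_density0 s u) (forward_densityS s u)).
Qed.

Lemma backward_mixing t v i :
  pi_variance pi (backward_density t v i) * (p * i.+1%:R) <= 20 * #|V|%:R.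
Proof.
exact: (variance_evolution_mixing V2 p0 ppi pi1 (cB t) (stB t)
  (erefl : backward_density t v 0 = dirac_density pi v) (fun=> erefl)).
Qed.

Lemma backward_nash t v i :
  pi_variance pi (backward_density t v i) ^+ 2 * (p ^+ 2 * i.+1%:R) <= 160.
Proof.
exact: (variance_evolution_nash V2 p0 ppi pi1 (cB t) (stB t)
  (erefl : backward_density t v 0 = dirac_density pi v) (fun=> erefl)).
Qed.

(** Chapman-Kolmogorov at time $s + i$ writes $p_{u,v}/\pi(v)$ as the inner product of the
two densities; both have mean 1. *)
Lemma walk_prob_cauchy_schwarz s i j u v :
  (P s (s + i + j) u v / pi v - 1) ^+ 2
    <= pi_variance pi (forward_density s u i)
       * pi_variance pi (backward_density (s + i + j) v j).
Proof.
have [_ f1] : density pi (forward_density s u i).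
  exact: (density_evolution V2 p0 ppi (cG' s) (stG' s) (forward_density0 s u) (forward_densityS s u)).
have [_ b1] : density pi (backward_density (s + i + j) v j).
  by apply: (density_evolution V2 p0 ppi (cB (s + i + j)) (stB (s + i + j)) (u := v)).
set f := forward_density s u i in f1 *; set b := backward_density _ v j in b1 *.
suff -> : P s (s + i + j) u v / pi v - 1 = \sum_w pi w * ((f w - 1) * (b w - 1)).
  by apply: cauchy_schwarz_sum => w; exact: ltW.
have -> : \sum_w pi w * ((f w - 1) * (b w - 1))
    = \sum_w (pi w * (f w * b w) - pi w * f w - pi w * b w + pi w).
  by apply: eq_bigr => w _; ring.
have -> : P s (s + i + j) u v / pi v = \sum_w pi w * (f w * b w).
  rewrite (@walk_prob_cat _ _ _ s (s + i)) ?leq_addr // mulr_suml.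
  apply: eq_bigr => w _; rewrite /f /b backward_densityE ?leq_addl // addnK.
  by rewrite /forward_density; field; rewrite !gt_eqF.
by rewrite big_split /= !sumrB f1 b1 pi1; ring.
Qed.

(** $x$ and $y$ are the variances of the two densities after half of the time. *)
Lemma walk_prob_half s k u v :
  exists x y : R, [/\ 0 <= x, 0 <= y,
    (P s (s + k) u v / pi v - 1) ^+ 2 <= x * y &
    [/\ x * (p * k.+1%:R) <= 40 * #|V|%:R, y * (p * k.+1%:R) <= 40 * #|V|%:R,
      x ^+ 2 * (p ^+ 2 * k.+1%:R) <= 320 & y ^+ 2 * (p ^+ 2 * k.+1%:R) <= 320]].
Proof.
have ek : (s + k = s + k./2 + (k - k./2))%N by rewrite -addnA subnKC // leq_half_double; lia.
have half i (z b : R) : (k <= i.*2.+1)%N -> 0 <= z -> z * i.+1%:R <= b ->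
    z * k.+1%:R <= 2 * b.
  move=> ki z0 h; apply: (@le_trans _ _ (z * (2 * i.+1%:R))); last by lra.
  by rewrite ler_wpM2l // -natrM ler_nat; lia.
have k1 : (k <= k./2.*2.+1)%N by lia.
have k2 : (k <= (k - k./2).*2.+1)%N by lia.
set x := pi_variance pi (forward_density s u k./2).
set y := pi_variance pi (backward_density (s + k) v (k - k./2)).
have x0 : 0 <= x by apply: pi_variance_ge0 => w; exact: ltW.
have y0 : 0 <= y by apply: pi_variance_ge0 => w; exact: ltW.
exists x, y; split=> //.
  by rewrite /y ek; exact: walk_prob_cauchy_schwarz.
have e40 : 40 * #|V|%:R = 2 * (20 * #|V|%:R) :> R by ring.
have e320 : 320 = 2 * 160 :> R by ring.
have pn : 0 <= x * p /\ 0 <= y * p by split; rewrite mulr_ge0 ?(ltW p0).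
have pn2 : 0 <= x ^+ 2 * p ^+ 2 /\ 0 <= y ^+ 2 * p ^+ 2 by split; rewrite mulr_ge0 ?sqr_ge0.
rewrite e40 e320; split; rewrite mulrA.
- by apply: (half _ _ _ k1 pn.1); rewrite -mulrA; exact: forward_mixing.
- by apply: (half _ _ _ k2 pn.2); rewrite -mulrA; exact: backward_mixing.
- by apply: (half _ _ _ k1 pn2.1); rewrite -mulrA; exact: forward_nash.
- by apply: (half _ _ _ k2 pn2.2); rewrite -mulrA; exact: backward_nash.
Qed.

Lemma walk_prob_mixing s k u v :
  `|P s (s + k) u v / pi v - 1| * (p * k.+1%:R) <= 40 * #|V|%:R.
Proof.
have [x [y [x0 y0 axy [xb yb _ _]]]] := walk_prob_half s k u v.
set a := _ - 1 in axy *; set q := p * _ in xb yb *.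
have q0 : 0 <= q by rewrite mulr_ge0 // ltW.
have b0 : 0 <= 40 * #|V|%:R :> R by rewrite mulr_ge0.
have aq0 : 0 <= `|a| * q by rewrite mulr_ge0.
rewrite -ler_sqr ?nnegrE //.
rewrite exprMn real_normK ?num_real //.
apply: (@le_trans _ _ (x * q * (y * q))).
  by rewrite [leRHS]mulrACA -[q * q]expr2 ler_wpM2r ?sqr_ge0.
by rewrite expr2 ler_pM // mulr_ge0.
Qed.

Lemma walk_prob_nash s k u v :
  `|P s (s + k) u v / pi v - 1| * (p * Num.sqrt k.+1%:R) <= 18.
Proof.
have [x [y [x0 y0 axy [_ _ xb yb]]]] := walk_prob_half s k u v.
set a := _ - 1 in axy *.
(* the variances are bounded in square, so compare fourth powers: 320 ^ 2 <= 18 ^ 4 *)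
have p0' := ltW p0.
suff : (`|a| * (p * Num.sqrt k.+1%:R)) ^+ 4 <= 18 ^+ 4.
  by rewrite ler_pXn2r ?nnegrE ?mulr_ge0 ?sqrtr_ge0.
have -> : (`|a| * (p * Num.sqrt k.+1%:R)) ^+ 4
    = a ^+ 2 * a ^+ 2 * (p ^+ 2 * k.+1%:R) ^+ 2.
  rewrite -[X in _ * (_ * X) ^+ 2](@sqr_sqrtr _ k.+1%:R) //.
  by rewrite -!(real_normK (num_real a)); ring.
apply: (@le_trans _ _ (x ^+ 2 * (p ^+ 2 * k.+1%:R) * (y ^+ 2 * (p ^+ 2 * k.+1%:R)))).
  set q := p ^+ 2 * _.
  rewrite [leRHS]mulrACA -[q * q]expr2 ler_wpM2r ?sqr_ge0 //.
  have -> : x ^+ 2 * y ^+ 2 = x * y * (x * y) by ring.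
  by rewrite ler_pM ?sqr_ge0.
apply: (@le_trans _ _ (320 * 320)); last by lra.
by rewrite ler_pM // mulr_ge0 ?sqr_ge0 // mulr_ge0 ?sqr_ge0.
Qed.

End Mixing.

(** * Hitting times and expected visits *)

Section Hitting.
Context {R : realType} {V : finType}.
Variables (G : nat -> sgraph V) (u v : V).
Notation P := (walk_prob (R := R) G).

(** The probability of being at $y$ at time $t$ without having been at $v$ at any earlier
time; $y = v$ is allowed and gives the first-hit probability. *)
Definition avoid_prob (t : nat) (y : V) : R :=
  \sum_(x : {ffun 'I_t.+1 -> V} |
      [&& x ord0 == u, x ord_max == y
        & [forall s : 'I_t.+1, (s < t)%N ==> (x s != v)]]) traj_prob G x.

Definition survival (t : nat) : R := \sum_(y | y != v) avoid_prob t y.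

Lemma avoid_prob_hit t : avoid_prob t v = first_hit_prob G u v t.
Proof. by []. Qed.

Lemma avoid_prob_ge0 t y : 0 <= avoid_prob t y.
Proof.
by apply: sumr_ge0 => x _; apply: prodr_ge0 => s _; exact: lazy_ge0.
Qed.

Lemma avoid_prob0 y : avoid_prob 0 y = (u == y)%:R.
Proof.
have [uy|uy] := eqVneq u y; last first.
  apply: big_pred0 => x; apply/negP => /and3P[/eqP xu /eqP xy _].
  by case/eqP: uy; rewrite -xu -xy; congr (x _); apply: val_inj.
rewrite /avoid_prob (big_pred1 [ffun _ : 'I_1 => y]) => [|x].
  by rewrite /traj_prob big_ord0.
rewrite /=; apply/and3P/eqP => [[/eqP xu _ _]|->].
  by apply/ffunP => i; rewrite ffunE (ord1 i) -uy -xu.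
by rewrite !ffunE uy; split=> //; apply/forallP.
Qed.

Definition extend t (y : V) (x : {ffun 'I_t.+1 -> V}) : {ffun 'I_t.+2 -> V} :=
  [ffun i : 'I_t.+2 => if (i < t.+1)%N then x (inord i) else y].

Lemma extendE t y x i : (i < t.+1)%N -> extend (t := t) y x (inord i) = x (inord i).
Proof. by move=> it; rewrite ffunE inordK ?it // ltnW. Qed.

Lemma extend_last t y x : extend (t := t) y x ord_max = y.
Proof. by rewrite ffunE /= ltnn. Qed.

Lemma traj_prob_extend t y (x : {ffun 'I_t.+1 -> V}) :
  traj_prob G (extend y x) = traj_prob G x * lazy (G t.+1) (x ord_max) y :> R.
Proof.
rewrite /traj_prob big_ord_recr /=; congr (_ * _).
  apply: eq_bigr => s _; rewrite !extendE ?ltnS //; last by rewrite ltnW.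
have e : inord t.+1 = ord_max :> 'I_t.+2 by apply: val_inj; rewrite /= inordK.
have e' : inord t = ord_max :> 'I_t.+1 by apply: val_inj; rewrite /= inordK.
by rewrite e extend_last extendE // e'.
Qed.

(** A trajectory of length $t+1$ that ends at $y$ is one of length $t$ followed by $y$;
group by the position at time $t$. *)
Lemma avoid_probS t y :
  avoid_prob t.+1 y = \sum_(w | w != v) avoid_prob t w * lazy (G t.+1) w y.
Proof.
pose restr (x : {ffun 'I_t.+2 -> V}) := [ffun i : 'I_t.+1 => x (inord i)].
rewrite /avoid_prob (reindex_onto (extend (t := t) y) restr) /=; last first.
  move=> x /and3P[_ /eqP xy _]; apply/ffunP => i; rewrite /extend ffunE.
  case: ltnP => it; first by rewrite /restr ffunE inordK // inord_val.
  have -> : i = ord_max; last by [].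
  by apply: val_inj; apply/eqP; rewrite /= eqn_leq it -ltnS ltn_ord.
under eq_bigr do rewrite traj_prob_extend.
have Pe (x : {ffun 'I_t.+1 -> V}) :
  [&& extend y x ord0 == u, extend y x ord_max == y
        & [forall s : 'I_t.+2, (s < t.+1)%N ==> (extend y x s != v)]]
   && (restr (extend y x) == x) =
  [&& x ord0 == u, [forall s : 'I_t.+1, (s < t)%N ==> (x s != v)] & x ord_max != v].
  have -> : restr (extend y x) == x.
    apply/eqP/ffunP => i; rewrite ffunE extendE ?ltn_ord // inord_val //.
  have -> : extend y x ord0 = x ord0.
    rewrite ffunE /=; congr (x _); apply: val_inj; by rewrite /= inordK.
  rewrite extend_last eqxx andbT /=; congr (_ && _).
  apply/forallP/andP => [h|[/forallP h h'] s].
    have h1 (s : 'I_t.+1) : x s != v.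
      have := h (inord s); rewrite inordK; last by rewrite ltnW // ltnS ltn_ord.
      by rewrite ltn_ord /= extendE // inord_val.
    by split=> //; apply/forallP => s; rewrite h1 implybT.
  apply/implyP => st; rewrite -[s]inord_val extendE //.
  have := h (inord s); rewrite inordK //.
  have : (s <= t)%N by [].
  rewrite leq_eqVlt => /predU1P[e|->//] _.
  have <- : ord_max = inord s :> 'I_t.+1 by apply: val_inj; rewrite /= inordK.
  by [].
under eq_bigl do rewrite Pe.
rewrite (partition_big (fun x : {ffun 'I_t.+1 -> V} => x ord_max) (fun w => w != v)) /=;
  last by move=> x /and3P[].
apply: eq_bigr => w wv; rewrite mulr_suml; apply: eq_big => x.
  case: (x ord0 == u) => //=; rewrite andbC.
  by case: eqP => //= ->; rewrite wv andbT.
by case/andP=> _ /eqP ->.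
Qed.

Lemma survival_ge0 t : 0 <= survival t.
Proof. by apply: sumr_ge0 => y _; exact: avoid_prob_ge0. Qed.

Lemma sum_avoid_prob t : \sum_y avoid_prob t y = first_hit_prob G u v t + survival t.
Proof. by rewrite (bigD1 v). Qed.

Lemma survival0 : first_hit_prob G u v 0 + survival 0 = 1.
Proof.
rewrite -sum_avoid_prob (bigD1 u) //= big1 ?addr0 => [|y yu].
  by rewrite avoid_prob0 eqxx.
by rewrite avoid_prob0 eq_sym (negPf yu).
Qed.

Hypothesis degG : forall t x, (0 < degree (G t.+1) x)%N.

Lemma lazy_sum1 t x : \sum_y lazy (G t.+1) x y = 1 :> R.
Proof.
have -> : \sum_y lazy (G t.+1) x y = lazy_op (G t.+1) (fun=> 1) x :> R.
  by apply: eq_bigr => y _; rewrite mulr1.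
rewrite lazy_op_laplacian // big1 ?mulr0 ?addr0 // => y _; exact: subrr.
Qed.

Lemma survivalS t : first_hit_prob G u v t.+1 + survival t.+1 = survival t.
Proof.
rewrite -sum_avoid_prob; under eq_bigr do rewrite avoid_probS.
rewrite exchange_big; apply: eq_bigr => w _.
by rewrite -mulr_sumr lazy_sum1 mulr1.
Qed.

Lemma first_hit_prob_ge0 t : 0 <= first_hit_prob G u v t :> R.
Proof. exact: avoid_prob_ge0. Qed.

Lemma survival_noninc s t : (s <= t)%N -> survival t <= survival s.
Proof.
move=> st; rewrite -(subnKC st); elim: (t - s)%N => [|k ih]; first by rewrite addn0.
apply: le_trans ih; rewrite addnS -[leRHS]survivalS lerDr.
exact: first_hit_prob_ge0.
Qed.

Lemma survival_le1 t : survival t <= 1.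
Proof.
apply: le_trans (survival_noninc (leq0n t)) _.
by rewrite -survival0 lerDr; exact: first_hit_prob_ge0.
Qed.

Definition visits (s k : nat) (w : V) : R := \sum_(i < k) P s (s + i) w v.

Lemma visits_first_step s k w :
  visits s k.+1 w = (w == v)%:R + \sum_y lazy (G s.+1) w y * visits s.+1 k y.
Proof.
rewrite /visits big_ord_recl /= addn0 walk_prob_refl; congr (_ + _).
under [RHS]eq_bigr do rewrite mulr_sumr.
rewrite exchange_big; apply: eq_bigr => i _ /=.
by rewrite /bump /= add1n addnS walk_prob_first_step ?ltnS ?leq_addr // addSn.
Qed.

(** Let $e = s + k$ and let $g_t(w)$ be the expected number of visits to $v$ in $[t, e)$ from
$w$ at time $t$. The quantity $B\,S_t - \sum_{w \ne v} \alpha_t(w) g_t(w)$, with $S$ the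
survival probability and $\alpha$ the avoidance probability, does not increase with
$t$: away from $v$ the function $g$ is harmonic for the walk, and the mass $S_t -
S_{t+1}$ that arrives at $v$ takes along at most $B$ expected visits per unit. At
$t = e$ the sum vanishes. *)
Lemma survival_visits B K : (forall t j, (j <= K)%N -> visits t j v <= B) ->
  forall k s, (k <= K)%N ->
  B * survival (s + k)
    <= B * survival s - \sum_(w | w != v) avoid_prob s w * visits s k w.
Proof.
move=> hB; elim=> [|k ih] s kK.
  rewrite addn0 big1 ?subr0 // => w _.
  by rewrite /visits big_ord0 mulr0.
have -> : \sum_(w | w != v) avoid_prob s w * visits s k.+1 w
    = \sum_y avoid_prob s.+1 y * visits s.+1 k y.
  under [RHS]eq_bigr do rewrite avoid_probS mulr_suml.
  rewrite exchange_big; apply: eq_bigr => w wv.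
  rewrite visits_first_step (negPf wv) add0r mulr_sumr.
  by apply: eq_bigr => y _; rewrite mulrA.
rewrite (bigD1 v) //= -(survivalS s) addnS -addSn.
have := ih s.+1 (ltnW kK); have := hB s.+1 k (ltnW kK).
have := first_hit_prob_ge0 s.+1; rewrite avoid_prob_hit.
set h := first_hit_prob _ _ _ _; set X := visits _ _ _; set Y := \sum_(i | _) _.
move=> h0 XB; have : h * X <= h * B by rewrite ler_wpM2l.
lra.
Qed.

Lemma survival_contraction g B K :
    (forall t j, (j <= K)%N -> visits t j v <= B) ->
    (forall s w, g <= visits s K w) ->
  forall s, B * survival (s + K) <= (B - g) * survival s.
Proof.
move=> hB hg s; apply: le_trans (survival_visits hB s (leqnn K)) _.
rewrite mulrBl lerD2l lerN2 mulr_sumr; apply: ler_sum => w _.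
by rewrite mulrC ler_wpM2l ?avoid_prob_ge0.
Qed.

(** Split off the first $N$ terms of the sum up to $M + N$: a sum $\Sigma_M$ satisfies
$\Sigma_M \le \Sigma_{M+N} \le N + (1-q)\Sigma_M$. *)
Lemma sum_survival q N : (0 < q) -> (forall s, survival (s + N) <= (1 - q) * survival s) ->
  forall M, q * (\sum_(j < M) survival j) <= N%:R.
Proof.
move=> q0 h M.
have mono : \sum_(j < M) survival j <= \sum_(j < M + N) survival j.
  rewrite big_split_ord /= lerDl; apply: sumr_ge0 => j _; exact: survival_ge0.
have : \sum_(j < M + N) survival j
    <= N%:R + (1 - q) * \sum_(j < M) survival j.
  rewrite addnC big_split_ord /= lerD //.
    rewrite -[leRHS]mulr1 mulr_natl -[X in _ *+ X]card_ord -sumr_const.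
    by apply: ler_sum => j _; exact: survival_le1.
  by rewrite mulr_sumr; apply: ler_sum => j _; rewrite addnC.
lra.
Qed.

Lemma sum_first_hit_prob M :
  \sum_(0 <= t < M.+1) first_hit_prob G u v t = 1 - survival M.
Proof.
elim: M => [|M ih].
  by rewrite big_nat1 -survival0 addrK.
by rewrite big_nat_recr //= ih -(survivalS M); ring.
Qed.

Lemma sum_time_first_hit_prob M :
  \sum_(0 <= t < M.+1) t%:R * first_hit_prob G u v t
    = \sum_(j < M) survival j - M%:R * survival M.
Proof.
elim: M => [|M ih].
  by rewrite big_nat1 big_ord0 !mul0r subr0.
by rewrite big_nat_recr //= ih big_ord_recr /= -(survivalS M) -natr1; ring.
Qed.

(** The partial sums of the expectation are bounded by those of the tail sums. The
latter bound also forces the survival probability to vanish in the limit, so $v$ is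
hit almost surely and the infinite term of the expectation is $+\infty \cdot 0 = 0$. *)
Lemma expected_hitting_time_le (b : R) : (forall M, \sum_(j < M) survival j <= b) ->
  (expected_hitting_time G u v <= b%:E)%E.
Proof.
move=> hb.
have f0 := first_hit_prob_ge0.
have fE0 n : (0 <= (first_hit_prob G u v n)%:E :> \bar R)%E by rewrite lee_fin.
have tfE0 n : (0 <= (n%:R * first_hit_prob G u v n)%:E :> \bar R)%E.
  by rewrite lee_fin mulr_ge0.
have hit1 : (\sum_(0 <= t <oo) (first_hit_prob G u v t)%:E = 1 :> \bar R)%E.
  apply/eqP; rewrite eq_le; apply/andP; split.
    apply: lime_le; first by apply: is_cvg_nneseries => n _ _.
    apply: nearW => -[|M]; first by rewrite big_geq.
    by rewrite sumEFin lee_fin sum_first_hit_prob lerBlDr lerDl survival_ge0.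
  rewrite leNgt; apply/negP => lt1.
  (* a defect of the total mass bounds every survival probability below *)
  have [l l1 ltl] : exists2 l : R, l < 1 &
      (\sum_(0 <= t <oo) (first_hit_prob G u v t)%:E = l%:E :> \bar R)%E.
    have L0 : (0 <= \sum_(0 <= t <oo) (first_hit_prob G u v t)%:E :> \bar R)%E.
      exact: nneseries_ge0.
    move: lt1 L0; case: (limn _) => [l| |] //= l1 _.
    by exists l => //; rewrite -lte_fin.
  have surv M : 1 - l <= survival M.
    have := nneseries_lim_ge (u_ := fun t => (first_hit_prob G u v t)%:E)
      (P := xpredT) (m := 0) M.+1 (fun n _ _ => fE0 n).
    rewrite ltl sumEFin lee_fin sum_first_hit_prob; lra.
  have b0 : 0 <= b / (1 - l).
    rewrite divr_ge0 //; last by lra.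
    by apply: le_trans (hb 0%N); rewrite big_ord0.
  have := archi_boundP b0; set M := Num.Def.archi_bound _.
  rewrite ltr_pdivrMr; last by lra.
  apply/negP; rewrite -leNgt; apply: le_trans (hb M).
  rewrite mulr_natl -[X in _ *+ X]card_ord -sumr_const.
  by apply: ler_sum => j _; exact: surv.
rewrite /expected_hitting_time hit1 subee // mule0 adde0.
apply: lime_le; first by apply: is_cvg_nneseries => n _ _.
apply: nearW => -[|M]; rewrite sumEFin lee_fin.
  by rewrite big_geq //; apply: le_trans (hb 0%N); rewrite big_ord0.
rewrite sum_time_first_hit_prob; apply: le_trans (hb M).
by rewrite lerBlDr lerDl mulr_ge0 ?survival_ge0.
Qed.

End Hitting.

(** * Elementary sums *)

Section Sums.
Context {R : realType}.

Lemma harmonic_sum_le N : \sum_(i < N.+1) i.+1%:R^-1 <= 1 + ln N.+1%:R :> R.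
Proof.
elim: N => [|N ih]; first by rewrite big_ord1 ln1 addr0 invr1.
rewrite big_ord_recr /=; apply: le_trans (lerD ih (lexx _)) _.
rewrite -addrA lerD2l.
have e : N.+1%:R = N.+2%:R * (1 - N.+2%:R^-1) :> R.
  by rewrite mulrBr mulr1 divff ?pnatr_eq0 // -[N.+2%:R]natr1 addrK.
have N2 : 0 < 1 - N.+2%:R^-1 :> R.
  by rewrite subr_gt0 invf_lt1 ?ltr0n // ltr1n.
rewrite {1}e lnM ?posrE ?ltr0n // -addrA gerDl.
have := @le_ln1Dx R (- N.+2%:R^-1).
by rewrite ltrN2 invf_lt1 ?ltr0n // ltr1n => /(_ isT); rewrite -lerBrDr sub0r.
Qed.

Lemma inv_sqrt_sum_le N :
  \sum_(i < N) (Num.sqrt i.+1%:R)^-1 <= 2 * Num.sqrt N%:R :> R.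
Proof.
elim: N => [|N ih]; first by rewrite big_ord0 mulr_ge0 ?sqrtr_ge0.
rewrite big_ord_recr /=; apply: le_trans (lerD ih (lexx _)) _.
set a := Num.sqrt N%:R; set b := Num.sqrt N.+1%:R.
have a0 : 0 <= a by exact: sqrtr_ge0.
have b0 : 0 < b by rewrite sqrtr_gt0.
have ea : a ^+ 2 = N%:R by rewrite sqr_sqrtr.
have eb : b ^+ 2 = a ^+ 2 + 1 by rewrite ea sqr_sqrtr // natr1.
rewrite -lerBrDl -[leLHS]mul1r ler_pdivrMr //.
have := sqr_ge0 (b - a); nra.
Qed.

Lemma half_le_ln n : (1 < n)%N -> 1 / 2 <= ln n%:R :> R.
Proof.
move=> n1; have n0 : 0 < n%:R :> R by rewrite ltr0n ltnW.
have := @le_ln1Dx R (n%:R^-1 - 1).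
rewrite [1 + _]addrC subrK lnV ?posrE // => h.
have : n%:R^-1 <= 2^-1 :> R by rewrite lef_pV2 ?posrE // ler_nat.
have i0 : 0 < n%:R^-1 :> R by rewrite invr_gt0.
have {}h : - ln n%:R <= n%:R^-1 - 1 :> R by apply: h; lra.
lra.
Qed.
End Sums.

(** * Bounds on the expected hitting time *)

Section HittingBound.
Context {R : realType} {V : finType}.
Variables (G : nat -> sgraph V) (pi : V -> R) (p : R).
Hypotheses (V2 : (1 < #|V|)%N) (p0 : 0 < p) (ppi : forall x, p <= pi x)
  (cG : forall t, (1 <= t)%N -> connected_graph (G t))
  (stG : forall t, (1 <= t)%N -> stationary pi (G t)).
Notation P := (walk_prob (R := R) G).

(** In a window of length $2T$, the last $T$ instants see at least $T\pi(v)/2$ expected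
visits to $v$, by mixing, and there are at most $B = T\pi(v)(2 + \theta)$ of them after a
visit to $v$. So the window hits $v$ with probability at least $1/(2(2+\theta))$. *)
Lemma expected_hitting_time_visits T th (b : nat -> R) :
    (0 < T)%N -> 0 <= th -> 80 * #|V|%:R <= p * T.+1%:R ->
    (forall i, 0 <= b i) ->
    (forall s i w, `|P s (s + i) w w / pi w - 1| <= b i) ->
    \sum_(i < T + T) b i <= T%:R * th ->
  forall u v, (expected_hitting_time G u v <= (4 * T%:R * (2 + th))%:E)%E.
Proof.
move=> T0 th0 Tp b0 hb sumb u v.
have pi0 x : 0 < pi x by apply: lt_le_trans (ppi x).
have T0' : 0 < T%:R :> R by rewrite ltr0n.
have degG t x : (0 < degree (G t.+1) x)%N by apply: degree_gt0 => //; exact: cG.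
apply: expected_hitting_time_le => // M.
pose B := pi v * (T%:R * (2 + th)); pose g := pi v * T%:R / 2.
pose q : R := (2 * (2 + th))^-1.
have th2 : 0 < 2 + th by lra.
have q0 : 0 < q by rewrite invr_gt0 mulr_gt0.
have B0 : 0 < B by rewrite !mulr_gt0.
have visitsB t j : (j <= T + T)%N -> visits G v t j v <= B.
  move=> jT; apply: (@le_trans _ _ (\sum_(i < j) pi v * (1 + b i))).
    apply: ler_sum => i _; have := hb t i v; rewrite ler_norml => /andP[_].
    by rewrite lerBlDl ler_pdivrMr // mulrC.
  apply: (@le_trans _ _ (\sum_(i < T + T) pi v * (1 + b i))).
    rewrite -(subnKC jT) big_split_ord /= lerDl; apply: sumr_ge0 => i _.
    by rewrite mulr_ge0 ?addr_ge0 // ltW.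
  rewrite -mulr_sumr big_split /= /B ler_wpM2l ?(ltW (pi0 v)) //.
  by rewrite sumr_const card_ord natrD; lra.
have visitsg s w : g <= visits G v s (T + T) w.
  rewrite /visits big_split_ord /= -[leLHS]add0r lerD //.
    by apply: sumr_ge0 => i _; rewrite walk_prob_ge0 // leq_addr.
  rewrite /g -mulrA mulrCA mulr_natl -[X in _ *+ X]card_ord -sumr_const.
  apply: ler_sum => i _.
  have := walk_prob_mixing V2 p0 ppi cG stG s (T + i) w v.
  set a := `|_|.
  have pT : p * T.+1%:R <= p * (T + i).+1%:R.
    by rewrite ler_wpM2l ?(ltW p0) // ler_nat ltnS leq_addr.
  have n0 : 0 < #|V|%:R :> R by rewrite ltr0n ltnW.
  move=> h; have a2 : a <= 1 / 2.
    have : a * (80 * #|V|%:R) <= 40 * #|V|%:R.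
      by apply: le_trans h; rewrite ler_wpM2l ?normr_ge0 // (le_trans Tp).
    by rewrite -ler_pdivlMr ?mulr_gt0 // => /le_trans; apply; rewrite ler_pdivrMr ?mulr_gt0 //; lra.
  move: a2; rewrite /a ler_norml => /andP[+ _]; rewrite lerBrDl ler_pdivlMr //.
  lra.
have := @sum_survival R V G u v degG q (T + T) q0 _ M.
set Sm := \sum_(_ < M) _ => hM.
have {}hM : q * Sm <= (T + T)%:R.
  apply: hM => s.
  have := survival_contraction u degG visitsB visitsg s.
  have -> : B - g = B * (1 - q) by rewrite /B /g /q; field; rewrite gt_eqF.
  by rewrite -mulrA ler_pM2l.
move: hM; rewrite mulrC -ler_pdivlMr // /q invrK natrD; lra.
Qed.

(** Here $T$ is of order $n/p \le n^3$, so the harmonic sum over the window is of order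
$\log n$. *)
Lemma hitting_time_log u v :
    1 <= p * #|V|%:R ^+ 2 ->
  (expected_hitting_time G u v
    <= (5440 * (#|V|%:R * ln #|V|%:R / p))%:E)%E.
Proof.
move=> pn; set n : R := #|V|%:R in pn *; pose T := Num.truncn (80 * n / p).
have n2 : 2 <= n by rewrite /n ler_nat.
have x0 : 0 <= 80 * n / p by rewrite divr_ge0 ?mulr_ge0 ?(ltW p0) //; lra.
have /andP[Tle Tgt] := truncn_itv x0; rewrite -/T in Tle Tgt.
have p1 : p <= 1.
  have := card_pi_le1 ppi (stG (leqnn 1)).1.2; rewrite -/n; nra.
have T1 : (0 < T)%N.
  by rewrite truncn_gt0 ler_pdivlMr // mul1r; lra.
have T1' : 1 <= T%:R :> R by rewrite ler1n.
have h40 : 40 * n / p <= T%:R by move: Tgt; rewrite -natr1; lra.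
have lnn := half_le_ln (R := R) V2; rewrite -/n in lnn.
pose th : R := 1 + ln (T + T)%:R.
have TT : (T + T = (T + T).-1.+1)%N by rewrite prednK // addn_gt0 T1.
have ln0 : 0 <= ln (T + T)%:R :> R by rewrite ln_ge0 // ler1n TT.
have ln11 : ln (T + T)%:R <= 11 * ln n.
  have -> : 11 * ln n = ln (n ^+ 11) by rewrite lnXn ?mulr_natl //; lra.
  have n0 : 0 < n by lra.
  rewrite ler_ln ?posrE ?exprn_gt0 //; last by rewrite ltr0n TT.
  have ip : p^-1 <= n ^+ 2 by rewrite -[leLHS]mul1r ler_pdivrMr // mulrC.
  have T3 : T%:R <= 80 * n ^+ 3.
    apply: le_trans Tle _; rewrite exprS mulrA ler_wpM2l // mulr_ge0 //; lra.
  (* 160 n ^ 3 <= n ^ 11, because 160 <= 2 ^ 8 <= n ^ 8 *)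
  have n8 : 2 ^+ 8 <= n ^+ 8 by rewrite lerXn2r ?nnegrE //; lra.
  have : 2 ^+ 8 * n ^+ 3 <= n ^+ 8 * n ^+ 3 by rewrite ler_wpM2r // exprn_ge0 // ltW.
  rewrite -exprD natrD.
  have n3 : 0 <= n ^+ 3 by rewrite exprn_ge0 // ltW.
  lra.
have := @expected_hitting_time_visits T th (fun i => 40 * n / p / i.+1%:R) T1.
move=> /(_ _ _ _ _ _ u v) h; apply: le_trans (h _ _ _ _ _) _.
- by rewrite /th addr_ge0.
- by move: (ltW Tgt); rewrite ler_pdivrMr // [leRHS]mulrC.
- by move=> i; rewrite !mulr_ge0 ?invr_ge0 ?(ltW p0) //; lra.
- move=> s i w; have := walk_prob_mixing V2 p0 ppi cG stG s i w w.
  rewrite -/n mulrA -ler_pdivlMr // -ler_pdivlMr // => h'.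
  by apply: le_trans h' _; rewrite mulrAC.
- rewrite -mulr_sumr; apply: ler_pM => //.
  + by rewrite !mulr_ge0 ?invr_ge0 ?(ltW p0) //; lra.
  + by apply: sumr_ge0 => i _; rewrite invr_ge0.
  + by rewrite /th; have := @harmonic_sum_le R (T + T).-1; rewrite -TT.
rewrite lee_fin /th.
have -> : 5440 * (n * ln n / p) = 4 * (80 * n / p) * (17 * ln n) by ring.
by apply: ler_pM => //; rewrite ?mulr_ge0 //; lra.
Qed.

(** With $p = 1/n$ the window has length of order $n^2$, over which the bounds
$18n/\sqrt{i+1}$ sum to at most $6T$. *)
Lemma hitting_time_regular u v : p = #|V|%:R^-1 ->
  (expected_hitting_time G u v <= (2560 * #|V|%:R ^+ 2 : R)%:E)%E.
Proof.
move=> pn; set n : R := #|V|%:R in pn *.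
have n2 : 2 <= n by rewrite /n ler_nat.
pose T := (80 * #|V| ^ 2)%N.
have Tn : T%:R = 80 * n ^+ 2 :> R by rewrite natrM natrX.
have T1 : (0 < T)%N by rewrite /T muln_gt0 expn_gt0 (ltnW V2).
have := @expected_hitting_time_visits T 6 (fun i => 18 * n / Num.sqrt i.+1%:R) T1.
move=> /(_ _ _ _ _ _ u v) h; apply: le_trans (h _ _ _ _ _) _ => //.
- rewrite pn -/n -[T.+1%:R]natr1 Tn [leRHS]mulrC ler_pdivlMr; [nra|lra].
- by move=> i; rewrite !mulr_ge0 ?invr_ge0 ?sqrtr_ge0 //; lra.
- move=> s i w; have := walk_prob_nash V2 p0 ppi cG stG s i w w.
  rewrite mulrA -ler_pdivlMr ?sqrtr_gt0 // -ler_pdivlMr // => h'.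
  by apply: le_trans h' _; rewrite pn invrK mulrAC.
- rewrite -mulr_sumr.
  apply: (@le_trans _ _ (18 * n * (2 * (13 * n)))); last by rewrite Tn; nra.
  rewrite ler_wpM2l //; first by lra.
  apply: le_trans (inv_sqrt_sum_le _) _; rewrite ler_wpM2l //.
  have n13 : 0 <= 13 * n by lra.
  rewrite -(@ger0_norm _ (13 * n)) // -sqrtr_sqr ler_sqrt ?sqr_ge0 //.
  by rewrite natrD Tn; nra.
by rewrite lee_fin Tn; lra.
Qed.

End HittingBound.

(** * Mixing time, return probabilities and hitting times *)

Theorem mainTheorem1 (R : realType) :
  exists K : R, 0 < K /\
  forall (V : finType) (G : nat -> sgraph V) (pi : V -> R) (m : nat),
    (2 <= #|V|)%N ->
    (forall t, (1 <= t)%N -> connected_graph (G t)) ->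
    (forall t, (1 <= t)%N -> stationary pi (G t)) ->
    (forall t, (1 <= t)%N -> (#|edges (G t)| <= m)%N) ->
    [/\ (t_mix G pi <= (K * (#|V|%:R / pi_min pi))%:E)%E,
        (forall (u v : V) (t : nat), (1 <= t)%N ->
           `|walk_prob G 0 t u v / pi v - 1|
             <= K * (m%:R / t%:R + 1 / (pi_min pi * Num.sqrt t%:R)))
        /\ (forall d : nat,
             (forall t, (1 <= t)%N -> regular_graph d (G t)) ->
             forall (u v : V) (t : nat), (1 <= t)%N ->
               `|walk_prob G 0 t u v / pi v - 1|
                 <= K * (#|V|%:R / Num.sqrt t%:R))
      & (t_hit R G <= (K * (#|V|%:R * ln #|V|%:R / pi_min pi))%:E)%E
        /\ (forall d : nat,
             (forall t, (1 <= t)%N -> regular_graph d (G t)) ->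
             (t_hit R G <= (K * #|V|%:R ^+ 2)%:E)%E)].
Proof.
exists 5440; split; first by rewrite ltr0n.
move=> V G pi m V2 cG stG _.
have [[pi_ge0 pi1] _] := stG 1%N (leqnn 1).
have n2 : 2 <= #|V|%:R :> R by rewrite ler_nat.
have [c c0 piE] := stationary_degree V2 (cG 1%N (leqnn 1)) (stG 1%N (leqnn 1)).
set n : R := #|V|%:R in n2 *; have n0 : 0 < n by lra.
(* c is at most every pi x, and c times the sum of the degrees is 1 *)
have pmin_n : n ^- 2 <= pi_min pi.
  have c1 : n ^- 2 <= c.
    rewrite -[leLHS]mul1r ler_pdivrMr ?exprn_gt0 // -pi1.
    have -> : c * n ^+ 2 = \sum_(x : V) c * n.
      by rewrite sumr_const expr2 mulrA mulr_natr.
    apply: ler_sum => x _; rewrite piE ler_wpM2l ?(ltW c0) // ler_nat.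
    exact: max_card.
  apply: le_bigmin => [|x _].
    by rewrite invf_le1 ?exprn_gt0 // exprn_ege1 //; lra.
  apply: le_trans c1 _; rewrite piE ler_peMr ?(ltW c0) // ler1n.
  by apply: degree_gt0 => //; exact: cG.
have p0 : 0 < pi_min pi by apply: lt_le_trans pmin_n; rewrite invr_gt0 exprn_gt0.
have ppi x : pi_min pi <= pi x by exact: bigmin_le.
have reg d : (forall t, (1 <= t)%N -> regular_graph d (G t)) ->
    forall x, n^-1 <= pi x.
  move=> rG x; have e y : pi y = pi x by rewrite !piE !(rG 1%N).
  have : n * pi x = 1 by rewrite -pi1 mulr_natl -sumr_const; exact: eq_bigr.
  by move=> h; rewrite -[leLHS]mulr1 -h mulrA mulVf ?mul1r // gt_eqF.
have in0 : 0 < n^-1 by rewrite invr_gt0.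
have nash q (q0 : 0 < q) (hq : forall x, q <= pi x) u v t : (1 <= t)%N ->
    `|walk_prob G 0 t u v / pi v - 1| <= 18 * (1 / (q * Num.sqrt t%:R)).
  move=> t1; have s0 : 0 < Num.sqrt t%:R :> R by rewrite sqrtr_gt0 ltr0n.
  have := walk_prob_nash V2 q0 hq cG stG 0 t u v; rewrite add0n => h.
  rewrite mulrA mulr1 ler_pdivlMr ?mulr_gt0 //; apply: le_trans h.
  by rewrite ler_wpM2l ?normr_ge0 // ler_wpM2l ?(ltW q0) // ler_sqrt // ler_nat.
split; first 1 last.
- split=> [u v t t1|d rG u v t t1].
    apply: le_trans (nash _ p0 ppi u v t t1) _.
    have : 0 <= m%:R / t%:R :> R by rewrite divr_ge0.
    have : 0 <= 1 / (pi_min pi * Num.sqrt t%:R).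
      by rewrite divr_ge0 ?mulr_ge0 ?sqrtr_ge0 // ltW.
    lra.
  apply: le_trans (nash _ in0 (reg d rG) u v t t1) _.
  have -> : 1 / (n^-1 * Num.sqrt t%:R) = n / Num.sqrt t%:R.
    by rewrite invfM invrK mul1r.
  by rewrite ler_wpM2r ?divr_ge0 ?sqrtr_ge0 ?(ltW n0) //; lra.
- split=> [|d rG]; apply: bigmax_le => [|[u v] _]; rewrite ?leNye //=.
    apply: hitting_time_log => //.
    by rewrite -ler_pdivrMr ?exprn_gt0 // mul1r.
  apply: le_trans (hitting_time_regular V2 in0 (reg d rG) cG stG u v erefl) _.
  by rewrite lee_fin; apply: ler_wpM2r; [rewrite exprn_ge0 // ltW | rewrite ler_nat].
(* after 180 n / pi_min steps the variance is at most 1 / 9 *)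
have x0 : 0 <= 180 * n / pi_min pi by rewrite divr_ge0 ?mulr_ge0 ?(ltW p0) ?(ltW n0).
have /andP[Tle Tgt] := truncn_itv x0; set T := Num.truncn _ in Tle Tgt.
apply: (@le_trans _ _ T%:R%:E); last first.
  rewrite lee_fin; apply: le_trans Tle _; rewrite -mulrA ler_wpM2r //; last by lra.
  by rewrite divr_ge0 ?ltW.
apply: ereal_inf_lbound; exists T => // u.
rewrite /norm2 -[leRHS]ger0_norm; last by lra.
rewrite -sqrtr_sqr ler_sqrt ?sqr_ge0 //.
have := forward_mixing V2 p0 ppi cG stG 0 u T.
have -> : \sum_x (rho G pi T u x - 1) ^+ 2 * pi x
    = pi_variance pi (forward_density G pi 0 u T).
  by apply: eq_bigr => x _; rewrite mulrC /rho /forward_density add0n.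
move: Tgt; rewrite ltr_pdivrMr // [ltRHS]mulrC => Tgt.
set w := pi_variance _ _ => h.
have w0 : 0 <= w by apply: pi_variance_ge0.
have : w * (180 * n) <= 20 * n.
  by apply: le_trans h; rewrite ler_wpM2l // ltW.
by rewrite -ler_pdivlMr ?mulr_gt0 // => /le_trans; apply; rewrite ler_pdivrMr ?mulr_gt0 //; lra.
Qed.
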